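(* Let $m,l,t\ge1$. For $1\le i\le t$ let $g_i(x)$ be a monic divisor of $x^m-1$, $h_i(x)=\frac{x^m-1}{g_i(x)}$, and let $k_{i1}(x),\dots,k_{il}(x)\in\mathcal{R}$ with $\gcd(k_{i1},\dots,k_{il},h_i)=1$. Let $\mathcal{C}\subseteq\mathbb{F}^{ml}$ be the QC code generated by the $t$ tuples $(k_{i1}g_i,\dots,k_{il}g_i)$, $1\le i\le t$. Then: (A) (Here $\mathbb{F}=\mathbb{F}_q$.) $\mathcal{C}$ is Euclidean self-orthogonal if and only if for all $1\le r\le s\le t$: $h_r(x)\mid \overline{g_s}(x)\sum_{j=1}^{l}k_{rj}(x)\overline{k_{sj}}(x)$. (B) (Here $\mathbb{F}=\mathbb{F}_{q^2}$.) $\mathcal{C}$ is Hermitian self-orthogonal if and only if for all $1\le r\le s\le t$: $h_r^{[q]}(x)\mid \overline{g_s}(x)\sum_{j=1}^{l}k_{rj}^{[q]}(x)\overline{k_{sj}}(x)$. (C) (Here $\mathbb{F}=\mathbb{F}_q$, $l$ even, $\omega=l/2$.) $\mathcal{C}$ is symplectic self-orthogonal if and only if for all $1\le r\le s\le t$: $h_r(x)\mid \overline{g_s}(x)\sum_{j=1}^{\omega}\big(k_{rj}(x)\overline{k_{s(\omega+j)}}(x)-k_{r(\omega+j)}(x)\overline{k_{sj}}(x)\big)$.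
   Context: $q$ is a prime power, $\mathbb{F}$ is the base field indicated in each case, $\mathcal{R}=\mathbb{F}[x]/(x^m-1)$, and elements of $\mathcal{R}$ are identified with their representatives of degree $<m$. For $k(x)=\sum_{i=0}^{m-1}k_ix^i\in\mathcal{R}$: $[k(x)]=(k_0,\dots,k_{m-1})\in\mathbb{F}^m$; $\overline{k}(x)=k(x^{-1})\bmod (x^m-1)=k_0+k_{m-1}x+\dots+k_1x^{m-1}$; $k^{[q]}(x)=\sum_i k_i^qx^i$. For a divisor $h$ of $x^m-1$ and $a\in\mathcal{R}$, ''$h\mid a$'' means $h$ divides the representative of $a$ (well defined since $h\mid x^m-1$). The QC code of length $ml$ generated by tuples $(u_{i1},\dots,u_{il})\in\mathcal{R}^l$, $1\le i\le t$, is the set $\{([\sum_i r_iu_{i1}],\dots,[\sum_i r_iu_{il}]) : r_1,\dots,r_t\in\mathcal{R}\}\subseteq\mathbb{F}^{ml}$, vectors being concatenations of blocks of length $m$. Inner products on $\mathbb{F}^N$: Euclidean $\langle u,v\rangle_E=\sum u_iv_i$; Hermitian (over $\mathbb{F}_{q^2}$) $\langle u,v\rangle_H=\sum u_i^qv_i$; symplectic (for $N=2n$) $\langle u,v\rangle_S=\sum_{i=1}^n(u_iv_{n+i}-u_{n+i}v_i)$. A code $\mathcal{C}$ is self-orthogonal w.r.t. an inner product if $\mathcal{C}\subseteq\mathcal{C}^{\perp}$, the dual being $\{u:\langle u,c\rangle=0\ \forall c\in\mathcal{C}\}$. *)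

(* Defs.v *)
From HB Require Import structures.
From mathcomp Require Import all_boot all_order all_algebra.
Set Implicit Arguments. Unset Strict Implicit. Unset Printing Implicit Defensive.
Import GRing.Theory.
Local Open Scope ring_scope.

(* Ring R = F[x]/(x^m - 1); elements are represented by polynomials, and the
   canonical representative (degree < m) of p is p %% (x^m - 1). *)
Definition xm1 (F : fieldType) (m : nat) : {poly F} := 'X^m - 1.
Definition rrep (F : fieldType) (m : nat) (p : {poly F}) : {poly F} := p %% xm1 F m.

(* \overline{k}(x) = k(x^{-1}) mod (x^m - 1): coefficient i is k_{(m-i) mod m} *)
Definition rbar (F : fieldType) (m : nat) (p : {poly F}) : {poly F} :=
  \poly_(i < m) (rrep m p)`_((m - i) %% m)%N.

Definition rfrob (F : fieldType) (q : nat) (p : {poly F}) : {poly F} :=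
  map_poly (fun a : F => a ^+ q) p.

(* ([a_0], ..., [a_{l-1}]) in F^{ml}: concatenation of blocks of length m;
   position k of the vector is coefficient (k mod m) of block (k div m). *)
Definition qc_vec (F : fieldType) (m l : nat) (a : nat -> {poly F}) : 'rV[F]_(m * l) :=
  \row_(k < m * l) (rrep m (a (k %/ m)%N))`_(k %% m)%N.

Definition qc_code (F : fieldType) (m l t : nat) (u : nat -> nat -> {poly F})
  : 'rV[F]_(m * l) -> Prop :=
  fun c => exists r : nat -> {poly F},
    c = qc_vec m l (fun j => \sum_(i < t) r i * u i j).

Definition ipE (F : fieldType) (N : nat) (u v : 'rV[F]_N) : F :=
  \sum_(i < N) u 0 i * v 0 i.

Definition ipH (F : fieldType) (q N : nat) (u v : 'rV[F]_N) : F :=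
  \sum_(i < N) (u 0 i) ^+ q * v 0 i.

Definition vcoord (F : fieldType) (N : nat) (u : 'rV[F]_N) (k : nat) : F :=
  nth 0 [seq u 0 i | i <- enum 'I_N] k.

Definition ipS (F : fieldType) (N : nat) (u v : 'rV[F]_N) : F :=
  \sum_(i < N./2) (vcoord u i * vcoord v (N./2 + i)
                   - vcoord u (N./2 + i) * vcoord v i).

Definition dual (F : fieldType) (N : nat) (ip : 'rV[F]_N -> 'rV[F]_N -> F)
  (C : 'rV[F]_N -> Prop) : 'rV[F]_N -> Prop :=
  fun u => forall c, C c -> ip u c = 0.

Definition self_orthogonal (F : fieldType) (N : nat)
  (ip : 'rV[F]_N -> 'rV[F]_N -> F) (C : 'rV[F]_N -> Prop) : Prop :=
  forall c, C c -> dual ip C c.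

Arguments rrep {F} m p.
Arguments rbar {F} m p.
Arguments rfrob {F} q p.
Arguments qc_vec {F} m l a.
Arguments qc_code {F} m l t u _.

(* Main.v *)
(** Modulo [x ^ m - 1] the constant coefficient of [a * bar b] is the dot product
    of the coefficient vectors of [a] and [b], and the pairing it defines is
    nondegenerate. Hence the code is self-orthogonal iff, for all generators
    [u_r] and [u_s], the polynomial form of [u_r] and [u_s] vanishes modulo
    [x ^ m - 1]; as [x ^ m - 1 = g_r h_r], cancelling [g_r] leaves the
    divisibility by [h_r]. Swapping [r] and [s] applies an involution to the form,
    up to sign, so the pairs with [r <= s] suffice. *)

Require Import Defs.
From HB Require Import structures.
From mathcomp Require Import all_boot all_order all_algebra all_field.
From mathcomp Require Import zify.
Set Implicit Arguments. Unset Strict Implicit. Unset Printing Implicit Defensive.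
Import GRing.Theory.
Local Open Scope ring_scope.

(** * Arithmetic modulo [x ^ m - 1] and the bar operation *)

Section CyclicRing.

Variables (F : fieldType) (m : nat).
Hypothesis m_gt0 : (0 < m)%N.
Implicit Types p q a b d : {poly F}.

Fact rrep_is_linear : linear (@rrep F m).
Proof. by move=> c p q; rewrite /rrep modpD modpZl. Qed.

HB.instance Definition _ :=
  GRing.isLinear.Build F {poly F} {poly F} *:%R (@rrep F m) rrep_is_linear.

Lemma rrepMl p q : rrep m (rrep m p * q) = rrep m (p * q).
Proof. by rewrite /rrep mulrC modp_mul mulrC. Qed.

Lemma rrepMr p q : rrep m (p * rrep m q) = rrep m (p * q).
Proof. by rewrite /rrep modp_mul. Qed.

Lemma rrep_id p : rrep m (rrep m p) = rrep m p.
Proof. by have := rrepMr 1 p; rewrite !mul1r. Qed.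

Lemma rrep_mul p p' q q' :
  rrep m p = rrep m p' -> rrep m q = rrep m q' -> rrep m (p * q) = rrep m (p' * q').
Proof. by move=> ep eq; rewrite -rrepMl -rrepMr ep eq rrepMr rrepMl. Qed.

Lemma rrep_exp p q n : rrep m p = rrep m q -> rrep m (p ^+ n) = rrep m (q ^+ n).
Proof. by move=> e; elim: n => // n IH; rewrite !exprS; apply: rrep_mul. Qed.

Lemma rrep_eq0 p : (rrep m p == 0) = (xm1 F m %| p).
Proof. by []. Qed.

Lemma dvdp_rrep d p : d %| xm1 F m -> (d %| rrep m p) = (d %| p).
Proof. by move=> dm; rewrite /rrep -dvdp_mod. Qed.

Lemma size_xm1 : size (xm1 F m) = m.+1.
Proof. by rewrite size_XnsubC. Qed.

Lemma xm1_neq0 : xm1 F m != 0.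
Proof. by rewrite -size_poly_gt0 size_xm1. Qed.

Lemma size_rrep p : (size (rrep m p) <= m)%N.
Proof. by rewrite -ltnS -size_xm1 ltn_modp xm1_neq0. Qed.

Lemma rrep_expand p : rrep m p = \sum_(i < m) (rrep m p)`_i *: 'X^i.
Proof.
rewrite -(poly_def m (fun i => (rrep m p)`_i)); apply/polyP => i.
rewrite coef_poly; case: ltnP => // mi.
by rewrite nth_default // (leq_trans (size_rrep p)).
Qed.

Lemma rrep_Xn n : rrep m 'X^n = 'X^(n %% m) :> {poly F}.
Proof.
have Xm : rrep m 'X^m = rrep m 1 :> {poly F}.
  apply/eqP; rewrite -subr_eq0 -raddfB; exact: dvdpp.
rewrite {1}(divn_eq n m) mulnC exprD exprM.
transitivity (rrep m 'X^(n %% m) : {poly F}).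
  by rewrite -[in RHS](mul1r 'X^_) -(expr1n _ (n %/ m)); apply: rrep_mul => //; apply: rrep_exp.
by rewrite /rrep modp_small // size_polyXn size_xm1 ltnS ltn_pmod.
Qed.

Lemma eq_rrep_Xn n n' :
  (n = n' %[mod m])%N -> rrep m 'X^n = rrep m 'X^n' :> {poly F}.
Proof. by rewrite !rrep_Xn => ->. Qed.

Lemma coef0_rrep_Xn n : (rrep m 'X^n : {poly F})`_0 = (m %| n)%:R.
Proof. by rewrite rrep_Xn coefXn eq_sym. Qed.

(* [x ^ (m - 1)] represents [x ^ (-1)], so this substitution is a ring
   endomorphism of F[x] that induces the bar operation modulo [x ^ m - 1]. *)
Definition xinv p := p \Po 'X^(m.-1).

HB.instance Definition _ := GRing.RMorphism.copy xinv (comp_poly 'X^(m.-1)).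

Lemma xinvZ c p : xinv (c *: p) = c *: xinv p.
Proof. exact: comp_polyZ. Qed.

Lemma xinvXn n : xinv 'X^n = 'X^(n * m.-1).
Proof. by rewrite /xinv comp_Xn_poly -exprM mulnC. Qed.

(** The substitution sends [x ^ m - 1] to [x ^ (m * (m - 1)) - 1], again a multiple of [x ^ m - 1];
    hence [xinv] is well defined on residue classes. *)
Lemma dvd_xinv p : xm1 F m %| p -> xm1 F m %| xinv p.
Proof.
case/dvdpP => q ->; rewrite rmorphM /= dvdp_mull // rmorphB rmorph1 /= xinvXn.
rewrite -rrep_eq0 raddfB /= -(expr0 'X) subr_eq0; apply/eqP/eq_rrep_Xn.
by rewrite mulnC modnMl mod0n.
Qed.

Lemma eq_rrep_xinv p q : rrep m p = rrep m q -> rrep m (xinv p) = rrep m (xinv q).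
Proof.
move/eqP; rewrite -subr_eq0 -raddfB rrep_eq0 => /dvd_xinv.
by rewrite raddfB -rrep_eq0 raddfB subr_eq0 => /eqP.
Qed.

(** Exponents get multiplied by [(m - 1) ^ 2], which is 1 modulo [m]. *)
Lemma xinvK p : rrep m (xinv (xinv p)) = rrep m p.
Proof.
rewrite -[p]coefK poly_def !raddf_sum; apply: eq_bigr => i _.
rewrite /= !xinvZ !linearZ !xinvXn /=; congr (_ *: _); apply: eq_rrep_Xn.
case: m m_gt0 => // n _ /=.
have e : (i * n.+1 + i * n * n = i * n * n.+1 + i)%N by lia.
by rewrite -(modnMDl i (i * n * n)) e modnMDl.
Qed.

(** Allows the ring morphism [xinv] to stand in for [rbar], which is defined coefficientwise and is
    not itself multiplicative on polynomials. *)
Lemma rrep_rbar p : rrep m (rbar m p) = rrep m (xinv p).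
Proof.
rewrite -(eq_rrep_xinv (rrep_id p)) [X in xinv X]rrep_expand /rbar poly_def.
rewrite !raddf_sum /=.
(* [f] is negation of indices modulo [m]; the outer remainder sends [m] back to 0 when [i = 0]. *)
pose f (i : 'I_m) := Ordinal (ltn_pmod (m - i) m_gt0).
have fE (i : 'I_m) : ((f i) = (if i == 0%N :> nat then 0%N else m - i)%N :> nat).
  rewrite /=; case: eqP => [-> | /eqP i0]; first by rewrite subn0 modnn.
  by rewrite modn_small // ltn_subrL lt0n i0.
have fK : involutive f.
  move=> i; apply: ord_inj; rewrite !fE.
  by have := ltn_ord i; have := m_gt0; do 2!case: ifPn; lia.
rewrite (reindex_inj (inv_inj fK)) /=; apply: eq_bigr => i _.
rewrite xinvZ xinvXn !linearZ /=; have -> : ((m - (m - i) %% m) %% m = i)%N by exact: (congr1 val (fK i)).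
congr (_ *: _); apply: eq_rrep_Xn; rewrite modn_mod.
have e : (m + i * m.-1 = i * m + (m - i))%N.
  by have := ltn_ord i; have := m_gt0; nia.
by rewrite -(modnMDl i (m - i)) -e modnDl.
Qed.

(** In the double expansion, the term of indices [i], [j] carries [x ^ (i + j * (m - 1))], which
    reduces to 1 exactly when [i = j]. *)
Lemma coef0_rrep_xinv a b :
  (rrep m (a * xinv b))`_0 = \sum_(i < m) (rrep m a)`_i * (rrep m b)`_i.
Proof.
have -> : rrep m (a * xinv b) = rrep m (rrep m a * xinv (rrep m b)).
  by apply: rrep_mul; rewrite ?rrep_id // (eq_rrep_xinv (rrep_id b)).
rewrite [X in X * _]rrep_expand [X in xinv X]rrep_expand raddf_sum mulr_suml.
rewrite raddf_sum coef_sum; apply: eq_bigr => i _.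
rewrite mulr_sumr raddf_sum coef_sum (bigD1 i) //= big1 => [|j ji].
  rewrite addr0 xinvZ xinvXn -scalerAl -scalerAr !linearZ /= -exprD !coefZ.
  by rewrite coef0_rrep_Xn -mulnS prednK // dvdn_mull // mulr1.
rewrite xinvZ xinvXn -scalerAl -scalerAr !linearZ /= -exprD !coefZ coef0_rrep_Xn.
suff /negPf-> : ~~ (m %| i + j * m.-1)%N by rewrite !mulr0.
apply: contra ji => mij; rewrite -val_eqE /= -(modn_small (ltn_ord i)).
rewrite -(modn_small (ltn_ord j)) eq_sym -(eqn_modDr (j * m.-1)) -mulnS prednK //.
by rewrite modnMl.
Qed.

(** Nondegeneracy of the pairing: [r = x ^ i] reads off the coefficient [i] of the residue of
    [p]. *)
Lemma dvd_xm1_coef0 p :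
  (forall r, (rrep m (xinv r * p))`_0 = 0) -> xm1 F m %| p.
Proof.
move=> p0; rewrite -rrep_eq0 rrep_expand big1 // => i _.
have := p0 'X^i; rewrite mulrC coef0_rrep_xinv (bigD1 i) //= big1 => [|j ji].
  by rewrite addr0 rrep_Xn modn_small // coefXn eqxx mulr1 => ->; rewrite scale0r.
by rewrite rrep_Xn modn_small // coefXn [_ == _](negPf ji) mulr0.
Qed.

End CyclicRing.

(** * Block coordinates and self-orthogonality of QC codes *)

Lemma sum_blocks (F : fieldType) (m l : nat) (G : nat -> nat -> F) :
  (0 < m)%N ->
  \sum_(k < m * l) G (k %/ m)%N (k %% m)%N = \sum_(j < l) \sum_(i < m) G j i.
Proof.
move=> m_gt0; elim: l => [|l IH]; first by rewrite muln0 !big_ord0.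
rewrite mulnSr big_split_ord /= IH big_ord_recr /=; congr (_ + _).
apply: eq_bigr => i _; rewrite mulnC divnMDl // divn_small // addn0.
by rewrite modnMDl modn_small.
Qed.

Lemma vcoord_qc_vec (F : fieldType) (m l k : nat) (a : nat -> {poly F}) :
  (k < m * l)%N -> vcoord (qc_vec m l a) k = (rrep m (a (k %/ m)%N))`_(k %% m)%N.
Proof.
move=> kml; rewrite /vcoord (nth_map (Ordinal kml)) ?size_enum_ord //.
by rewrite mxE nth_enum_ord.
Qed.

Lemma self_orthogonal_qcP (F : fieldType) (m l t : nat) (u : nat -> nat -> {poly F})
    (ip : 'rV[F]_(m * l) -> 'rV[F]_(m * l) -> F) :
  self_orthogonal ip (qc_code m l t u) <->
  forall r r' : nat -> {poly F},
    ip (qc_vec m l (fun j => \sum_(i < t) r i * u i j))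
       (qc_vec m l (fun j => \sum_(i < t) r' i * u i j)) = 0.
Proof.
split=> [so r r' | so c [r ->] c' [r' ->]]; last exact: so.
by apply: so; [exists r | exists r'].
Qed.

(** * The twisted form and the divisibility criterion *)

Section TwistedForm.

Variables (F : fieldType) (m l : nat).
Hypothesis m_gt0 : (0 < m)%N.
Variables (phi : {rmorphism F -> F}) (e : 'I_l -> F) (delta : F).
Variable sig : 'I_l -> 'I_l.
Implicit Types (p : {poly F}) (a b : nat -> {poly F}).

Local Notation phiP := (map_poly phi).

(* With [phi] the identity or the q-th power map, [sig] the identity or the swap
   of the two halves of the block indices, and [e] the signs, this covers the
   Euclidean, Hermitian and symplectic products at once: each of them is the
   constant coefficient of this form modulo [x ^ m - 1]. *)
Definition tform a b : {poly F} :=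
  \sum_(j < l) e j *: (phiP (a j) * xinv m (b (sig j))).

Lemma tformZ (r r' : {poly F}) a b :
  tform (fun j => r * a j) (fun j => r' * b j) = phiP r * xinv m r' * tform a b.
Proof.
rewrite /tform mulr_sumr; apply: eq_bigr => j _.
by rewrite !rmorphM /= -!scalerAr mulrACA.
Qed.

Lemma tform_suml (t : nat) (a : nat -> nat -> {poly F}) b :
  tform (fun j => \sum_(i < t) a i j) b = \sum_(i < t) tform (a i) b.
Proof.
rewrite /tform exchange_big; apply: eq_bigr => j _.
by rewrite raddf_sum /= mulr_suml scaler_sumr.
Qed.

Lemma tform_sumr (t : nat) a (b : nat -> nat -> {poly F}) :
  tform a (fun j => \sum_(i < t) b i j) = \sum_(i < t) tform a (b i).
Proof.
rewrite /tform exchange_big; apply: eq_bigr => j _.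
by rewrite raddf_sum /= mulr_sumr scaler_sumr.
Qed.

Lemma map_xm1 : phiP (xm1 F m) = xm1 F m.
Proof. by rewrite rmorphB rmorph1 /= map_polyXn. Qed.

Lemma rrep_map p : rrep m (phiP (rrep m p)) = rrep m (phiP p).
Proof. by rewrite {2}/rrep map_modp map_xm1 [LHS]rrep_id. Qed.

Lemma map_xinv p : phiP (xinv m p) = xinv m (phiP p).
Proof. by rewrite /xinv map_comp_poly map_polyXn. Qed.

Lemma coef0_tform a b :
  (rrep m (tform a b))`_0 =
  \sum_(j < l) e j *
    \sum_(i < m) phi (rrep m (a j))`_i * (rrep m (b (sig j)))`_i.
Proof.
rewrite raddf_sum coef_sum; apply: eq_bigr => j _; rewrite /= linearZ coefZ /=.
rewrite coef0_rrep_xinv //; congr (_ * _); apply: eq_bigr => i _.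
by rewrite -coef_map /= {2}/rrep map_modp map_xm1.
Qed.

Hypotheses (phiK : involutive phi) (sigK : involutive sig).
Hypotheses (delta_neq0 : delta != 0) (e_sig : forall j, phi (e (sig j)) = delta * e j).

Lemma map_phiK : involutive phiP.
Proof. by move=> p; apply/polyP => i; rewrite !coef_map /= phiK. Qed.

(** Both [phiP] and [xinv] are involutions modulo [x ^ m - 1], so applying them moves the twist from
    one argument to the other. Reindexing by [sig] restores the shape of the form, and [e_sig] pays
    for it with the factor [delta]. *)
Lemma tform_swap a b : rrep m (xinv m (phiP (tform a b))) = rrep m (delta *: tform b a).
Proof.
rewrite /tform scaler_sumr !raddf_sum (reindex_inj (inv_inj sigK)) /=.
apply: eq_bigr => j _; rewrite map_polyZ /= xinvZ e_sig scalerA !linearZ /=.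
congr (_ *: _); rewrite !rmorphM /= map_phiK map_xinv sigK mulrC.
by apply: rrep_mul => //; rewrite xinvK.
Qed.

Lemma dvd_tform_swap a b : xm1 F m %| tform a b -> xm1 F m %| tform b a.
Proof.
rewrite -(dvdp_map phi) map_xm1 => /(dvd_xinv m_gt0).
by rewrite -rrep_eq0 tform_swap rrep_eq0 dvdpZr.
Qed.

Lemma tform_orthogonalP (t : nat) (u : nat -> nat -> {poly F}) :
  (forall r r' : nat -> {poly F},
     (rrep m (tform (fun j => \sum_(i < t) r i * u i j)
                    (fun j => \sum_(i < t) r' i * u i j)))`_0 = 0) <->
  (forall i i', (i <= i')%N -> (i' < t)%N -> xm1 F m %| tform (u i) (u i')).
Proof.
have E (r r' : nat -> {poly F}) :
    tform (fun j => \sum_(i < t) r i * u i j) (fun j => \sum_(i < t) r' i * u i j) =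
    \sum_(i < t) \sum_(i' < t) phiP (r i) * xinv m (r' i') * tform (u i) (u i').
  rewrite (tform_suml t (fun i j => r i * u i j)); apply: eq_bigr => i _.
  rewrite (tform_sumr t _ (fun i j => r' i * u i j)); apply: eq_bigr => i' _.
  exact: tformZ.
split=> [orth i i' ii' i't | dvd r r'].
  have it := leq_ltn_trans ii' i't; apply: dvd_xm1_coef0 => // p.
  (* Indicator multipliers isolate the single term [xinv m p * tform (u i) (u i')]; as [p] is
     arbitrary, nondegeneracy applies. *)
  have := orth (fun n => (n == i)%:R) (fun n => (n == i')%:R * p).
  rewrite (E (fun n => (n == i)%:R) (fun n => (n == i')%:R * p)) (bigD1 (Ordinal it)) //= [X in _ + X]big1 => [|j ji]; last first.
    by rewrite big1 // => j' _; rewrite [j == i :> nat](negPf ji) raddf0 !mul0r.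
  rewrite addr0 (bigD1 (Ordinal i't)) //= big1 => [|j ji].
    by rewrite addr0 !eqxx rmorph1 !mul1r.
  by rewrite [j == i' :> nat](negPf ji) mul0r raddf0 mulr0 mul0r.
suff : xm1 F m %| tform (fun j => \sum_(i < t) r i * u i j)
                        (fun j => \sum_(i < t) r' i * u i j).
  by rewrite -rrep_eq0 => /eqP->; rewrite coef0.
rewrite E; elim/big_ind: _ => [||i _]; [exact: dvdp0 | exact: dvdp_add |].
elim/big_ind: _ => [||i' _]; [exact: dvdp0 | exact: dvdp_add |].
(* The pairs with [i' < i] are recovered by swapping the arguments. *)
apply: dvdp_mull; have [ii'|/ltnW ii'] := leqP i i'; first exact: dvd.
by apply: dvd_tform_swap; apply: dvd.
Qed.

(** The form factors as [phiP g * xinv m g' * tform a b], and [x ^ m - 1 = phiP h * phiP g] since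
    [phiP] fixes [x ^ m - 1]; then [phiP g] cancels. Reducing what remains is harmless because
    [phiP h] divides [x ^ m - 1]. *)
Lemma dvd_tform_gen (g g' : {poly F}) (a b : nat -> {poly F}) :
  g %| xm1 F m ->
  (xm1 F m %| tform (fun j => a j * g) (fun j => b j * g')) =
  (phiP (xm1 F m %/ g) %|
     rrep m (rbar m g' *
             \sum_(j < l) e j *: (phiP (rrep m (a j)) * rbar m (b (sig j))))).
Proof.
move=> gm; have gE := divpK gm; set h := xm1 F m %/ g in gE *.
have g0 : phiP g != 0.
  rewrite map_poly_eq0; apply: contra_eq_neq gE => ->.
  by rewrite mulr0 eq_sym xm1_neq0.
have hm : phiP h %| xm1 F m by rewrite -map_xm1 -gE rmorphM dvdp_mulr.
have -> : tform (fun j => a j * g) (fun j => b j * g') =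
          (xinv m g' * tform a b) * phiP g.
  rewrite [RHS]mulrC mulrA -tformZ; apply: eq_bigr => j _.
  by rewrite ![_ * g]mulrC ![_ * g']mulrC.
rewrite -{1}map_xm1 -gE rmorphM /= dvdp_mul2r // -(dvdp_rrep (_ * tform a b) hm); congr (_ %| _).
apply: rrep_mul; first by rewrite rrep_rbar.
rewrite !raddf_sum; apply: eq_bigr => j _; rewrite /= !linearZ; congr (_ *: _).
by apply: rrep_mul; rewrite ?rrep_map ?rrep_rbar.
Qed.

Lemma self_orthogonal_tform (ip : 'rV[F]_(m * l) -> 'rV[F]_(m * l) -> F)
    (t : nat) (g : nat -> {poly F}) (k : nat -> nat -> {poly F}) :
  (forall a b, ip (qc_vec m l a) (qc_vec m l b) = (rrep m (tform a b))`_0) ->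
  (forall i, (i < t)%N -> g i %| xm1 F m) ->
  self_orthogonal ip (qc_code m l t (fun i j => k i j * g i)) <->
  (forall r s, (r <= s)%N -> (s < t)%N ->
     phiP (xm1 F m %/ g r) %|
       rrep m (rbar m (g s) *
               \sum_(j < l) e j *: (phiP (rrep m (k r j)) * rbar m (k s (sig j))))).
Proof.
move=> ipE gm; rewrite self_orthogonal_qcP.
have [so_dvd dvd_so] := tform_orthogonalP t (fun i j => k i j * g i).
split=> [so r s rs st | dvd r r']; last first.
  rewrite ipE; apply: dvd_so => {r r'} r s rs st.
  by rewrite dvd_tform_gen ?dvd // gm // (leq_ltn_trans rs).
rewrite -dvd_tform_gen ?gm ?(leq_ltn_trans rs) //.
apply: so_dvd rs st => r' s'.
by rewrite -ipE.
Qed.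

End TwistedForm.

(** * The inner products as constant coefficients of twisted forms *)

Section Products.

Variables (F : fieldType) (m : nat).
Hypothesis m_gt0 : (0 < m)%N.
Implicit Types a b : nat -> {poly F}.

(** Serves the Euclidean product with [phi] the identity and the Hermitian one with [phi] the q-th
    power. *)
Lemma coef0_tform_id (phi : {rmorphism F -> F}) l a b :
  (rrep m (tform m phi (fun=> 1) (@id 'I_l) a b))`_0 =
  \sum_(k < m * l) phi (qc_vec m l a 0 k) * qc_vec m l b 0 k.
Proof.
rewrite coef0_tform //.
under [RHS]eq_bigr => k _ do rewrite !mxE.
rewrite (sum_blocks l (fun j i => phi (rrep m (a j))`_i * (rrep m (b j))`_i)) //.
by apply: eq_bigr => j _; rewrite mul1r.
Qed.

Definition half_swap n (j : 'I_(n + n)) : 'I_(n + n) :=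
  match split j with inl i => rshift n i | inr i => lshift n i end.

Definition half_sign n (j : 'I_(n + n)) : F := if split j is inl _ then 1 else -1.

Lemma half_swap_lshift n (i : 'I_n) : half_swap (lshift n i) = rshift n i.
Proof. by rewrite /half_swap (unsplitK (inl i)). Qed.

Lemma half_swap_rshift n (i : 'I_n) : half_swap (rshift n i) = lshift n i.
Proof. by rewrite /half_swap (unsplitK (inr i)). Qed.

Lemma half_sign_lshift n (i : 'I_n) : half_sign (lshift n i) = 1.
Proof. by rewrite /half_sign (unsplitK (inl i)). Qed.

Lemma half_sign_rshift n (i : 'I_n) : half_sign (rshift n i) = -1.
Proof. by rewrite /half_sign (unsplitK (inr i)). Qed.

Lemma half_swapK n : involutive (@half_swap n).
Proof.
by move=> j; case: (split_ordP j) => i ->;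
   rewrite !(half_swap_lshift, half_swap_rshift).
Qed.

(** Antisymmetry of the symplectic product: the swap condition holds with [delta = -1]. *)
Lemma half_sign_swap n (j : 'I_(n + n)) : half_sign (half_swap j) = -1 * half_sign j.
Proof.
case: (split_ordP j) => i ->; rewrite (half_swap_lshift, half_swap_rshift).
  by rewrite half_sign_lshift half_sign_rshift mulr1.
by rewrite half_sign_lshift half_sign_rshift mulN1r opprK.
Qed.

(** Stated over any module so as to apply both to scalars, for the inner product, and to
    polynomials, for the criterion. *)
Lemma sum_half_swap (V : lmodType F) n (G : nat -> nat -> V) :
  \sum_(j < n + n) half_sign j *: G j (half_swap j) =
  \sum_(j < n) (G j (n + j)%N - G (n + j)%N j).
Proof.
rewrite big_split_ord /= -big_split; apply: eq_bigr => j _ /=.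
rewrite half_sign_lshift half_sign_rshift half_swap_lshift half_swap_rshift.
by rewrite scale1r scaleN1r.
Qed.

Lemma coef0_tform_half n a b :
  (rrep m (tform m idfun (@half_sign n) (@half_swap n) a b))`_0 =
  ipS (qc_vec m (n + n) a) (qc_vec m (n + n) b).
Proof.
rewrite coef0_tform // /ipS.
rewrite (@sum_half_swap F^o n (fun j j' => \sum_(i < m) (rrep m (a j))`_i * (rrep m (b j'))`_i)).
have -> : ((m * (n + n))./2 = m * n)%N by lia.
rewrite -(eq_bigr _ (fun j _ => sumrB _ _ _ _)) /=.
rewrite -(sum_blocks n (fun j i =>
  (rrep m (a j))`_i * (rrep m (b (n + j)%N))`_i
  - (rrep m (a (n + j)%N))`_i * (rrep m (b j))`_i)) //.
apply: eq_bigr => -[k kmn] _ /=.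
rewrite !vcoord_qc_vec; [|lia..].
(* An offset of [m * n] coordinates shifts by [n] whole blocks and keeps the position inside the
   block. *)
by rewrite [(m * n)%N]mulnC divnMDl // modnMDl.
Qed.

End Products.

(** The cardinality of [F] is a power of its characteristic [p], and the positive exponent [n.+1]
    transfers this to [q]; raising to a power of [p] is additive. *)
Lemma frobenius_rmorphism (F : finFieldType) (q n : nat) :
  #|F| = (q ^ n.+1)%N -> {phi : {rmorphism F -> F} | phi =1 fun x => x ^+ q}.
Proof.
move=> cardF; have [p p_pr charF] := finPcharP F.
have pq : [char F].-nat q.
  have : p.-nat #|F| by rewrite -cardsT; exact: (pprimeChar_pgroup charF).
  rewrite cardF pnatX orbF; apply: sub_in_pnat => r _ /eqP ->; exact: charF.
have q_gt0 : (0 < q)%N by case/andP: pq.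
have frobB : zmod_morphism (fun x : F => x ^+ q).
  move=> x y; rewrite exprDn_pchar //; congr (_ + _).
  (* The sign comes out whatever the parity of [q]: [(- y) ^ q + y ^ q = 0 ^ q = 0], as [q > 0]. *)
  by apply/eqP; rewrite -subr_eq0 opprK -exprDn_pchar // addNr expr0n gtn_eqF.
have frobM : monoid_morphism (fun x : F => x ^+ q).
  by split=> [|x y]; rewrite ?expr1n ?exprMn.
pose fA := GRing.isZmodMorphism.Build F F _ frobB.
pose fM := GRing.isMonoidMorphism.Build F F _ frobM.
pose phi : {rmorphism F -> F} := HB.pack (fun x : F => x ^+ q) fA fM.
by exists phi.
Qed.

(* Indices are 0-based: i, r, s range over 0..t-1 and j over 0..l-1. *)
Theorem mainTheorem2 (m l t : nat) (Hm : (0 < m)%N) (Hl : (0 < l)%N) (Ht : (0 < t)%N) :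
  (* (A) Euclidean, F = F_q *)
  (forall (F : finFieldType) (g : nat -> {poly F}) (k : nat -> nat -> {poly F}),
     let h := fun i => xm1 F m %/ g i in
     (forall i, (i < t)%N -> g i \is monic) ->
     (forall i, (i < t)%N -> g i %| xm1 F m) ->
     (forall i, (i < t)%N ->
        coprimep (\big[@gcdp F/0]_(j < l) rrep m (k i j)) (h i)) ->
     (self_orthogonal (@ipE F (m * l))
        (qc_code m l t (fun i j => k i j * g i))
      <->
      (forall r s, (r <= s)%N -> (s < t)%N ->
         h r %| rrep m (rbar m (g s) *
                        \sum_(j < l) rrep m (k r j) * rbar m (k s j))))) /\
  (* (B) Hermitian, F = F_{q^2} *)
  (forall (q : nat) (F : finFieldType) (g : nat -> {poly F}) (k : nat -> nat -> {poly F}),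
     #|F| = (q ^ 2)%N ->
     let h := fun i => xm1 F m %/ g i in
     (forall i, (i < t)%N -> g i \is monic) ->
     (forall i, (i < t)%N -> g i %| xm1 F m) ->
     (forall i, (i < t)%N ->
        coprimep (\big[@gcdp F/0]_(j < l) rrep m (k i j)) (h i)) ->
     (self_orthogonal (@ipH F q (m * l))
        (qc_code m l t (fun i j => k i j * g i))
      <->
      (forall r s, (r <= s)%N -> (s < t)%N ->
         rfrob q (h r) %| rrep m (rbar m (g s) *
                        \sum_(j < l) rfrob q (rrep m (k r j)) * rbar m (k s j))))) /\
  (* (C) symplectic, F = F_q, l even, omega = l/2 *)
  (~~ odd l ->
   forall (F : finFieldType) (g : nat -> {poly F}) (k : nat -> nat -> {poly F}),
     let h := fun i => xm1 F m %/ g i in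
     (forall i, (i < t)%N -> g i \is monic) ->
     (forall i, (i < t)%N -> g i %| xm1 F m) ->
     (forall i, (i < t)%N ->
        coprimep (\big[@gcdp F/0]_(j < l) rrep m (k i j)) (h i)) ->
     (self_orthogonal (@ipS F (m * l))
        (qc_code m l t (fun i j => k i j * g i))
      <->
      (forall r s, (r <= s)%N -> (s < t)%N ->
         h r %| rrep m (rbar m (g s) *
                  \sum_(j < l./2) (rrep m (k r j) * rbar m (k s (l./2 + j)%N)
                                   - rrep m (k r (l./2 + j)%N) * rbar m (k s j)))))).
Proof.
have idK (F : fieldType) : involutive (idfun : {rmorphism F -> F}) by [].
split; [|split].
- move=> F g k h _ gm _.
  have -> := @self_orthogonal_tform F m l Hm idfun (fun=> 1) 1 id (idK F)
    (fun=> erefl) (oner_neq0 F) (fun=> esym (mulr1 1)) (@ipE F (m * l)) t g k _ gm;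
    last by move=> a b; rewrite coef0_tform_id.
  have E r s : \sum_(j < l) 1 *: (map_poly idfun (rrep m (k r j)) * rbar m (k s j))
             = \sum_(j < l) rrep m (k r j) * rbar m (k s j).
    by apply: eq_bigr => j _; rewrite scale1r map_poly_id.
  by split=> dvd r s rs st; have := dvd r s rs st; rewrite E map_poly_id.
- move=> q F g k cardF h _ gm _.
  have [phi phiE] := frobenius_rmorphism cardF.
  have phiP p : map_poly phi p = rfrob q p by exact: eq_map_poly.
  (* Applying [phi] twice raises to the power [q ^ 2], the order of the field. *)
  have phiK : involutive phi by move=> x; rewrite !phiE -exprM mulnn -cardF expf_card.
  have -> := @self_orthogonal_tform F m l Hm phi (fun=> 1) 1 id phiK
    (fun=> erefl) (oner_neq0 F) _ (@ipH F q (m * l)) t g k _ gm; first last.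
  + move=> a b; rewrite coef0_tform_id //.
    by apply: eq_bigr => i _; rewrite phiE.
  + by move=> j; rewrite rmorph1 mulr1.
  have E r s : \sum_(j < l) 1 *: (map_poly phi (rrep m (k r j)) * rbar m (k s j))
             = \sum_(j < l) rfrob q (rrep m (k r j)) * rbar m (k s j).
    by apply: eq_bigr => j _; rewrite scale1r phiP.
  by split=> dvd r s rs st; have := dvd r s rs st; rewrite E phiP.
move=> l_even F g k h _ gm _.
have lE : l = (l./2 + l./2)%N by rewrite addnn even_halfK.
(* Writing [l] as [n + n] gives the block indices the type on which [half_swap] acts. *)
move: (l./2) lE => n lE; subst l.
have -> := @self_orthogonal_tform F m (n + n) Hm idfun (@half_sign F n) (-1)
  (@half_swap n) (idK F) (@half_swapK n) _ (@half_sign_swap F n)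
  (@ipS F (m * (n + n))) t g k _ gm; first last.
- by move=> a b; rewrite coef0_tform_half.
- by rewrite oppr_eq0 oner_neq0.
have E r s :
    \sum_(j < n + n) half_sign F j *:
       (map_poly idfun (rrep m (k r j)) * rbar m (k s (half_swap j)))
    = \sum_(j < n) (rrep m (k r j) * rbar m (k s (n + j)%N)
                    - rrep m (k r (n + j)%N) * rbar m (k s j)).
  rewrite -(sum_half_swap n (fun j j' => rrep m (k r j) * rbar m (k s j'))).
  by apply: eq_bigr => j _; rewrite map_poly_id.
by split=> dvd r s rs st; have := dvd r s rs st; rewrite E map_poly_id.
Qed.
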